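(* The category $\mathtt{Alg}(\mathsf{Lie})$ of algebras over the symmetric operad $\mathsf{Lie}$ is isomorphic (as a category) to the category $\mathtt{LieAlg}_{\mathbb K}$ of Lie algebras over $\mathbb K$. The isomorphism is established by the functor $F:\mathtt{Alg}(\mathsf{Lie})\to\mathtt{LieAlg}_{\mathbb K}$, $F(V,\Phi)=(V,\Phi_2(\ell))$, $F(f)=f$, and the functor $G:\mathtt{LieAlg}_{\mathbb K}\to\mathtt{Alg}(\mathsf{Lie})$, $G(\mathfrak g,[-,-])=(\mathfrak g,\Phi)$, $G(g)=g$, where $\Phi:\mathsf{Lie}\to\mathrm{End}^{\mathrm{sym}}_{\mathfrak g}$ is the unique operad morphism with $\Phi_2(\ell)=[-,-]$.
   Context: $\mathbb K$ is a field of characteristic $0$; vector spaces, linear maps and tensor products are over $\mathbb K$. $\mathbb S_n$ is the symmetric group. A (linear) symmetric operad $\mathcal P$ consists of vector spaces $\mathcal P(n)$, $n\ge0$, each with a right linear action of $\mathbb S_n$, linear composition maps $\mathcal P(n)\otimes\mathcal P(k_1)\otimes\cdots\otimes\mathcal P(k_n)\to\mathcal P(k_1+\cdots+k_n)$, written $\theta\circ(\theta_1,\dots,\theta_n)$ or $\gamma(\theta;\theta_1,\dots,\theta_n)$, and a unit $1\in\mathcal P(1)$, satisfying: associativity $\theta\circ(\theta_1\circ(\theta_{1,1},\dots,\theta_{1,k_1}),\dots,\theta_n\circ(\theta_{n,1},\dots,\theta_{n,k_n}))=(\theta\circ(\theta_1,\dots,\theta_n))\circ(\theta_{1,1},\dots,\theta_{n,k_n})$;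 unit $\theta\circ(1,\dots,1)=\theta=1\circ\theta$; equivariance $(\theta\cdot\sigma)\circ(\theta_{\sigma(1)}\cdot\pi_{\sigma(1)},\dots,\theta_{\sigma(n)}\cdot\pi_{\sigma(n)})=(\theta\circ(\theta_1,\dots,\theta_n))\cdot\rho$ for $\theta\in\mathcal P(n)$, $\theta_i\in\mathcal P(k_i)$, $\sigma\in\mathbb S_n$, $\pi_i\in\mathbb S_{k_i}$, where $\rho\in\mathbb S_{k_1+\cdots+k_n}$ is the block permutation sending the $j$-th element of the $i$-th block of the domain (cut into consecutive blocks of sizes $k_{\sigma(1)},\dots,k_{\sigma(n)}$) to the $\pi_{\sigma(i)}(j)$-th element of the $\sigma(i)$-th block of the codomain (cut into consecutive blocks of sizes $k_1,\dots,k_n$). Morphisms of symmetric operads are families of linear maps preserving composition, unit and the $\mathbb S_n$-actions. For a vector space $V$, $\mathrm{End}_V^{\mathrm{sym}}(n)=\mathrm{Hom}(V^{\otimes n},V)$ with composition of multilinear maps, unit $\mathrm{id}_V$, and $(f\cdot\sigma)(v_1\otimes\cdots\otimes v_n)=f(v_{\sigma^{-1}(1)}\otimes\cdots\otimes v_{\sigma^{-1}(n)})$. A $\mathcal P$-algebra is a pair $(V,\Phi)$ with $\Phi:\mathcal P\to\mathrm{End}_V^{\mathrm{sym}}$ a morphism of symmetric operads; a morphism $(V,\Phi^V)\to(W,\Phi^W)$ is a linear map $f:V\to W$ with $f\circ\Phi^V_n(\theta)=\Phi^W_n(\theta)\circ f^{\otimes n}$ for all $n$, $\theta\in\mathcal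 P(n)$. These form $\mathtt{Alg}(\mathcal P)$. Free operad: for a collection of sets $P=\{P(n)\}_{n\ge0}$, $\mathcal T(P)$ denotes the free symmetric operad on $P$, i.e. a symmetric operad with maps of sets $i_n:P(n)\to\mathcal T(P)(n)$ such that any family of maps of sets $f_n:P(n)\to\mathcal Q(n)$ to a symmetric operad $\mathcal Q$ extends uniquely to an operad morphism $\tilde f:\mathcal T(P)\to\mathcal Q$ with $\tilde f_n\circ i_n=f_n$. An operadic ideal $\mathcal I$ of $\mathcal P$ is a collection of $\mathbb S_n$-stable subspaces $\mathcal I(n)\subseteq\mathcal P(n)$ such that $\gamma(\mu;\nu_1,\dots,\nu_k)\in\mathcal I$ whenever $\mu$ or one of the $\nu_j$ is in $\mathcal I$; $\mathcal P/\mathcal I$ is the quotient operad, with $(\mathcal P/\mathcal I)(n)=\mathcal P(n)/\mathcal I(n)$ and induced operations. $(R)$ is the smallest ideal containing $R$, and $\langle P\mid R\rangle=\mathcal T(P)/(R)$. The operad $\mathsf{Lie}=\langle P\mid R\rangle$: $P(2)=\{\ell\}$, $P(n)=\varnothing$ for $n\ne2$ and $R$ consists of the two relations $\ell+\ell\cdot\tau=0$, with $\tau\in\mathbb S_2$ the transposition, and $\ell\circ(\ell,1)+(\ell\circ(\ell,1))\cdot\sigma+(\ell\circ(\ell,1))\cdot\sigma^2=0$, with $\sigma\in\mathbb S_3$, $\sigma(1)=2,\sigma(2)=3,\sigma(3)=1$. The class of $\ell$ in $\mathsf{Lie}(2)$ is again denoted $\ell$. A Lie algebra is a vector space $\mathfrak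 g$ with a bilinear bracket satisfying $[x,x]=0$ and the Jacobi identity; morphisms are linear maps preserving brackets. *)

(* Defs.v *)
From HB Require Import structures.
From mathcomp Require Import all_boot all_order all_algebra all_fingroup.
From mathcomp Require Import boolp classical_sets functions.

Set Implicit Arguments.
Unset Strict Implicit.
Unset Printing Implicit Defensive.

Import GRing.Theory.
Local Open Scope ring_scope.
Local Open Scope quotient_scope.

Section Multilinear.
Variable K : fieldType.

(* [dfwith v x] is the family [v] with its [i]-th entry replaced by [x]. *)
Definition multilinear n (V : 'I_n -> lmodType K) (W : lmodType K)
    (f : (forall i, V i) -> W) : Prop :=
  forall (v : forall i, V i) (i : 'I_n), linear (fun x : V i => f (dfwith v x)).

Lemma multilinearP n (V : 'I_n -> lmodType K) (W : lmodType K)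
    (f : (forall i, V i) -> W) :
  multilinear f <->
  (forall i a (u v w : forall i, V i), u i = a *: v i + w i ->
     (forall j, j != i -> u j = v j /\ u j = w j) -> f u = a *: f v + f w).
Proof.
split=> [fP i a u v w ui uj|fP v i a x y].
  have E (t : forall i, V i) : (forall j, j != i -> u j = t j) ->
      t = dfwith u (i := i) (t i).
    move=> ut; apply: functional_extensionality_dep => j.
    by case: dfwithP => // j'; rewrite eq_sym => /ut.
  rewrite [in LHS](E u) // ui fP -(E v) -?(E w) // => j /uj[] //.
apply: (fP i); first by rewrite !dfwith_in.
by move=> j; rewrite eq_sym => ij; rewrite !dfwith_out.
Qed.

End Multilinear.

(* The index set 'I_(\sum_i k i) is cut into consecutive blocks of sizes [k i]:
   [tagnat.sig1 p] is the block of [p], [tagnat.sig2 p] its position in that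
   block, and [tagnat.Rank i j] is the [j]-th element of the [i]-th block.
   [block_perm] below is the permutation [rho] of the equivariance law.  *)
Section BlockPerm.
Variables (n : nat) (k : 'I_n -> nat) (s : 'S_n) (t : forall i, 'S_(k i)).
Variables (m : nat) (e1 : (\sum_(i < n) k (s i))%N = m)
          (e2 : (\sum_(i < n) k i)%N = m).

Definition block_fun (p : 'I_m) : 'I_m :=
  let q := cast_ord (esym e1) p in
  let i := tagnat.sig1 q in
  cast_ord e2 (tagnat.Rank (s i) (t (s i) (tagnat.sig2 q))).

Lemma block_fun_inj : injective block_fun.
Proof.
move=> p p' /cast_ord_inj/tagnat.rank_inj E; apply: (@cast_ord_inj _ _ (esym e1)).
apply: tagnat.sig_inj; move: E; rewrite /tagnat.sig1 /tagnat.sig2.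
move: (tagnat.sig _) (tagnat.sig _) => [i j] [i' j'] /= E.
have ii' : i = i' by apply: (@perm_inj _ s); move/(congr1 tag): E.
move: j' E; rewrite -ii' => j' /eqP; rewrite eq_Tagged /= => /eqP.
by move/perm_inj ->.
Qed.

Definition block_perm : 'S_m := perm block_fun_inj.

End BlockPerm.

Section Operads.
Variable K : fieldType.

(* [op_comp e x y] is x o (y_0, ..., y_(n-1)), viewed in arity [m] along
   [e : k_0 + ... + k_(n-1) = m]; this avoids transports in the axioms.
   The product of [{perm T}] is [(s * t) x = t (s x)], so the composite
   permutation "s after t" of the right action law is [(t * s)%g].  *)
Record operad : Type := Operad {
  op_sort :> nat -> lmodType K;
  op_act : forall n, op_sort n -> 'S_n -> op_sort n;
  op_one : op_sort 1;
  op_comp : forall n (k : 'I_n -> nat) m, (\sum_(i < n) k i)%N = m ->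
    op_sort n -> (forall i, op_sort (k i)) -> op_sort m;
  op_act_linear : forall n (s : 'S_n), linear (fun x => op_act x s);
  op_act1 : forall n (x : op_sort n), op_act x 1%g = x;
  op_actM : forall n (x : op_sort n) (s t : 'S_n),
    op_act (op_act x s) t = op_act x (t * s)%g;
  op_comp_linear : forall n (k : 'I_n -> nat) m (e : (\sum_(i < n) k i)%N = m)
    (y : forall i, op_sort (k i)), linear (fun x => op_comp e x y);
  op_comp_multilinear : forall n (k : 'I_n -> nat) m
    (e : (\sum_(i < n) k i)%N = m) (x : op_sort n), multilinear (op_comp e x);
  op_compA : forall n (k : 'I_n -> nat) (l : forall i, 'I_(k i) -> nat)
    (r : 'I_n -> nat) m
    (e : forall i, (\sum_(j < k i) l i j)%N = r i)
    (e1 : (\sum_(i < n) r i)%N = m)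
    (e2 : (\sum_(p < \sum_(i < n) k i) l (tagnat.sig1 p) (tagnat.sig2 p))%N = m)
    (x : op_sort n) (y : forall i, op_sort (k i))
    (z : forall i j, op_sort (l i j)),
    op_comp e1 x (fun i => op_comp (e i) (y i) (z i)) =
    op_comp e2 (op_comp erefl x y)
            (fun p => z (tagnat.sig1 p) (tagnat.sig2 p));
  op_compx1 : forall n (e : (\sum_(i < n) 1)%N = n) (x : op_sort n),
    op_comp e x (fun=> op_one) = x;
  op_comp1x : forall n (e : (\sum_(i < 1) n)%N = n) (x : op_sort n),
    op_comp e op_one (fun=> x) = x;
  op_equivariance : forall n (k : 'I_n -> nat) (s : 'S_n)
    (t : forall i, 'S_(k i)) m
    (e1 : (\sum_(i < n) k (s i))%N = m) (e2 : (\sum_(i < n) k i)%N = m)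
    (x : op_sort n) (y : forall i, op_sort (k i)),
    op_comp e1 (op_act x s) (fun i => op_act (y (s i)) (t (s i))) =
    op_act (op_comp e2 x y) (block_perm t e1 e2)
}.

Record operad_morph (P Q : operad) : Type := OperadMorph {
  mor_fun :> forall n, P n -> Q n;
  mor_linear : forall n, linear (@mor_fun n);
  mor_act : forall n (x : P n) (s : 'S_n),
    mor_fun (op_act x s) = op_act (mor_fun x) s;
  mor_one : mor_fun (op_one P) = op_one Q;
  mor_comp : forall n (k : 'I_n -> nat) m (e : (\sum_(i < n) k i)%N = m)
    (x : P n) (y : forall i, P (k i)),
    mor_fun (op_comp e x y) = op_comp e (mor_fun x) (fun i => mor_fun (y i))
}.

End Operads.

Section EndSpace.
Variables (K : fieldType) (V : lmodType K) (n : nat).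

Definition multilinear_pred : {pred ('I_n -> V) -> V} :=
  fun f => `[< @multilinear K n (fun=> V) V f >].

Fact multilinear_pred_closed : submod_closed multilinear_pred.
Proof.
split.
  by apply/asboolP => v i a x y; rewrite /GRing.zero /= scaler0 addr0.
move=> a f g /asboolP fP /asboolP gP; apply/asboolP => v i b x y.
have E w : (a *: f + g) w = a *: f w + g w by [].
rewrite /= !E fP gP !scalerDr !scalerA [a * b]mulrC addrACA.
by rewrite -!addrA.
Qed.
HB.instance Definition _ := GRing.isSubmodClosed.Build K (('I_n -> V) -> V)
  multilinear_pred multilinear_pred_closed.

(* Hom(V^{(x) n}, V), as the space of multilinear maps V^n -> V *)
Record end_space : Type := EndSpace {
  end_fun :> ('I_n -> V) -> V;
  _ : end_fun \in multilinear_pred }.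
HB.instance Definition _ := [isSub for end_fun].
HB.instance Definition _ := [Choice of end_space by <:].
HB.instance Definition _ := [SubChoice_isSubLmodule of end_space by <:].

Lemma end_multilinear (f : end_space) : @multilinear K n (fun=> V) V f.
Proof. by case: f => f fP; apply/asboolP. Qed.

Definition end_of (f : ('I_n -> V) -> V) (fP : @multilinear K n (fun=> V) V f) :
  end_space := EndSpace (introT (asboolP _) fP).

Lemma end_ext (f g : end_space) : (forall v, f v = g v) -> f = g.
Proof. by move=> fg; apply: val_inj; apply: funext. Qed.

End EndSpace.

(* a family indexed by 'I_m, read on the underlying natural numbers *)
Definition natfun (V : zmodType) m (v : 'I_m -> V) (i : nat) : V :=
  if insub i is Some j then v j else 0.

Lemma natfunE (V : zmodType) m m' (e : m' = m) (v : 'I_m -> V) (i : 'I_m') :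
  v (cast_ord e i) = natfun v i.
Proof. by subst m; rewrite cast_ord_id /natfun valK. Qed.

Lemma val_cast_Rank n (k : 'I_n -> nat) m (e : (\sum_(i < n) k i)%N = m)
    (i : 'I_n) (j : 'I_(k i)) :
  cast_ord e (tagnat.Rank i j) = (\sum_(i' < n | (i' < i)%N) k i' + j)%N :> nat.
Proof. exact: tagnat.RankEsum. Qed.

Section EndOperad.
Variables (K : fieldType) (V : lmodType K).

Fact end_act_subproof n (f : end_space V n) (s : 'S_n) :
  @multilinear K n (fun=> V) V (fun v => f (fun i => v (s^-1%g i))).
Proof.
apply/multilinearP => i a u v w ui uj.
have /multilinearP/(_ (s i)) fP := end_multilinear f.
apply: fP => [|j ji]; first by rewrite permK.
by apply: uj; apply: contraNneq ji => <-; rewrite permKV.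
Qed.
Definition end_act n (f : end_space V n) (s : 'S_n) : end_space V n :=
  end_of (@end_act_subproof n f s).

Fact end_one_subproof : @multilinear K 1 (fun=> V) V (fun v => v ord0).
Proof. by apply/multilinearP => i a u v w; rewrite (ord1 i). Qed.
Definition end_one : end_space V 1 := end_of end_one_subproof.

Section Comp.
Variables (n : nat) (k : 'I_n -> nat) (m : nat) (e : (\sum_(i < n) k i)%N = m).
Variables (f : end_space V n) (g : forall i, end_space V (k i)).

Definition end_comp_fun (v : 'I_m -> V) : V :=
  f (fun i => g i (fun j => v (cast_ord e (tagnat.Rank i j)))).

Fact end_comp_subproof : @multilinear K m (fun=> V) V end_comp_fun.
Proof.
apply/multilinearP => p a u v w up uj.
rewrite -[p](cast_ordKV e) -[cast_ord _ p]tagnat.sig2K in up uj.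
move: (tagnat.sig1 _) (tagnat.sig2 _) up uj => i j up uj.
have /multilinearP/(_ i) fP := end_multilinear f; apply: fP.
  have /multilinearP/(_ j) gP := end_multilinear (g i); apply: gP => // j' j'j.
  apply: uj; rewrite (inj_eq (@cast_ord_inj _ _ _)) -val_eqE tagnat.eq_Rank.
  by rewrite eqxx.
move=> i' i'i; split; congr (g i' _); apply: funext => j';
  apply uj; rewrite (inj_eq (@cast_ord_inj _ _ _)) -val_eqE tagnat.eq_Rank;
  by rewrite negb_and i'i.
Qed.
Definition end_comp : end_space V m := end_of end_comp_subproof.
End Comp.

Fact end_act_linear n (s : 'S_n) : linear (fun f => @end_act n f s).
Proof. by move=> a f g; apply: end_ext. Qed.

Fact end_act1 n (f : end_space V n) : end_act f 1%g = f.
Proof.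
apply: end_ext => v; congr (f _); apply: funext => i.
by rewrite invg1 perm1.
Qed.

Fact end_actM n (f : end_space V n) (s t : 'S_n) :
  end_act (end_act f s) t = end_act f (t * s)%g.
Proof.
apply: end_ext => v; congr (f _); apply: funext => i /=.
by rewrite invMg permM.
Qed.

Fact end_comp_linear n (k : 'I_n -> nat) m (e : (\sum_(i < n) k i)%N = m)
  (g : forall i, end_space V (k i)) : linear (fun f => end_comp e f g).
Proof. by move=> a f f'; apply: end_ext. Qed.

Fact end_comp_multilinear n (k : 'I_n -> nat) m
  (e : (\sum_(i < n) k i)%N = m) (f : end_space V n) :
  multilinear (end_comp e f).
Proof.
apply/multilinearP => i a u v w ui uj; apply: end_ext => x.
have /multilinearP/(_ i) fP := end_multilinear f; apply: fP.
  by rewrite ui.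
by move=> j /uj[<- <-].
Qed.

Lemma tagnat_comp_rank n (k : 'I_n -> nat) (l : forall i, 'I_(k i) -> nat)
    (r : 'I_n -> nat) (e : forall i, (\sum_(j < k i) l i j)%N = r i)
    (i : 'I_n) (j : 'I_(k i)) :
  (\sum_(i' < n | (i' < i)%N) r i' + \sum_(j' < k i | (j' < j)%N) l i j')%N =
  (\sum_(p < \sum_(i < n) k i | (p < tagnat.Rank i j)%N)
     l (tagnat.sig1 p) (tagnat.sig2 p))%N.
Proof.
pose Q i' (j' : 'I_(k i')) := (tagnat.Rank i' j' < tagnat.Rank i j)%N.
have QE i' (j' : 'I_(k i')) : Q i' j' = (i' < i)%N || (i' == i) && (j' < j)%N.
  rewrite /Q !tagnat.RankEsum; case: (ltngtP i' i) => [lt_i|gt_i|/val_inj E].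
  - rewrite orTb; apply: (@leq_trans (\sum_(q < n | (q < i)%N) k q)%N);
      last exact: leq_addr.
    rewrite [leqRHS](bigID (fun q : 'I_n => (q < i')%N)) /= -addnS.
    apply: leq_add; last by rewrite (bigD1 i') ?ltnn ?lt_i //=;
      apply: leq_trans (ltn_ord j') (leq_addr _ _).
    rewrite [leqRHS](eq_bigl (fun q : 'I_n => (q < i')%N)) // => q.
    by case: (ltnP q i') => [/ltn_trans/(_ lt_i)->|]; rewrite ?andbF.
  - rewrite -val_eqE gtn_eqF //=; apply/negbTE; rewrite -leqNgt.
    apply: (@leq_trans (\sum_(q < n | (q < i')%N) k q)%N); last exact: leq_addr.
    rewrite [leqRHS](bigID (fun q : 'I_n => (q < i)%N)) /=.
    apply: leq_add; last by rewrite (bigD1 i) ?ltnn ?gt_i //=;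
      apply: leq_trans (ltnW (ltn_ord j)) (leq_addr _ _).
    rewrite [leqRHS](eq_bigl (fun q : 'I_n => (q < i)%N)) // => q.
    by case: (ltnP q i) => [/ltn_trans/(_ gt_i)->|]; rewrite ?andbF.
  - by subst i'; rewrite ltn_add2l eqxx.
rewrite (reindex _ (onW_bij _ (@tagnat.rank_bij _ k))) /=.
pose G (p : {i & 'I_(k i)}) := l (tag p) (tagged p).
rewrite [RHS](eq_bigr G); last first.
  by move=> p _; rewrite /G /tagnat.sig1 /tagnat.sig2 tagnat.rankK.
rewrite [RHS](eq_bigl (fun p => true && Q (tag p) (tagged p))); last first.
  by case.
rewrite /G -(sig_big_dep xpredT (fun i : 'I_n => Q i) l) /= [RHS](bigID (fun q : 'I_n => (q < i)%N)) /=.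
congr addn.
  apply: eq_bigr => q lt_q; rewrite -e [RHS](eq_bigl xpredT) // => q'.
  by rewrite QE lt_q.
rewrite [RHS](bigD1 i) ?ltnn //= [X in (_ + X)%N]big1 ?addn0.
  by rewrite [RHS](eq_bigl (fun j' : 'I_(k i) => j' < j)%N) // => q'; rewrite QE ltnn eqxx.
move=> q /andP[/negbTE ge_q /negbTE ne_q].
by rewrite big_pred0 // => q'; rewrite QE ge_q ne_q.
Qed.

Fact end_compA n (k : 'I_n -> nat) (l : forall i, 'I_(k i) -> nat)
    (r : 'I_n -> nat) m
    (e : forall i, (\sum_(j < k i) l i j)%N = r i)
    (e1 : (\sum_(i < n) r i)%N = m)
    (e2 : (\sum_(p < \sum_(i < n) k i) l (tagnat.sig1 p) (tagnat.sig2 p))%N = m)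
    (x : end_space V n) (y : forall i, end_space V (k i))
    (z : forall i j, end_space V (l i j)) :
  end_comp e1 x (fun i => end_comp (e i) (y i) (z i)) =
  end_comp e2 (end_comp erefl x y)
           (fun p => z (tagnat.sig1 p) (tagnat.sig2 p)).
Proof.
apply: end_ext => v; congr (x _); apply: funext => i.
congr (y i _); apply: funext => j /=; rewrite cast_ord_id.
set p := tagnat.Rank i j.
set c := (\sum_(i' < n | (i' < i)%N) r i' +
          \sum_(j' < k i | (j' < j)%N) l i j')%N.
have -> : (fun q : 'I_(l (tagnat.sig1 p) (tagnat.sig2 p)) =>
             v (cast_ord e2 (tagnat.Rank p q))) = (fun q => natfun v (c + q)%N).
  apply: funext => q; rewrite natfunE tagnat.RankEsum; congr (natfun v (_ + q)%N).
  by rewrite /c (tagnat_comp_rank e).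
have -> : z (tagnat.sig1 p) (tagnat.sig2 p) (fun q => natfun v (c + q)%N) =
          z i j (fun q => natfun v (c + q)%N).
  rewrite /tagnat.sig1 /tagnat.sig2 /p /tagnat.Rank tagnat.rankK //.
congr (z i j _); apply: funext => q.
rewrite natfunE; congr (natfun v _).
by rewrite tagnat.RankEsum -addnA; congr addn; exact: tagnat.RankEsum.
Qed.

Fact end_compx1 n (e : (\sum_(i < n) 1)%N = n) (x : end_space V n) :
  end_comp e x (fun=> end_one) = x.
Proof.
apply: end_ext => v; congr (x _); apply: funext => i /=; congr v.
apply: ord_inj; rewrite val_cast_Rank.
rewrite addn0 -(big_ord_widen n (fun=> 1%N) (ltnW (ltn_ord i))).
by rewrite sum_nat_const card_ord muln1.
Qed.

Fact end_comp1x n (e : (\sum_(i < 1) n)%N = n) (x : end_space V n) :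
  end_comp e end_one (fun=> x) = x.
Proof.
apply: end_ext => v; congr (x _); apply: funext => j /=; congr v.
apply: ord_inj; rewrite val_cast_Rank.
by rewrite big1 // => -[[]].
Qed.

Fact end_equivariance n (k : 'I_n -> nat) (s : 'S_n)
    (t : forall i, 'S_(k i)) m
    (e1 : (\sum_(i < n) k (s i))%N = m) (e2 : (\sum_(i < n) k i)%N = m)
    (x : end_space V n) (y : forall i, end_space V (k i)) :
  end_comp e1 (end_act x s) (fun i => end_act (y (s i)) (t (s i))) =
  end_act (end_comp e2 x y) (block_perm t e1 e2).
Proof.
apply: end_ext => v; congr (x _); apply: funext => i /=.
rewrite -[i](permKV s) permK; move: (s^-1%g i) => {}i.
congr (y _ _); apply: funext => j; congr v.
apply: (@perm_inj _ (block_perm t e1 e2)); rewrite permKV permE /block_fun.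
rewrite cast_ordK /tagnat.sig1 /tagnat.sig2 /tagnat.Rank tagnat.rankK /=.
by rewrite permKV.
Qed.

Definition end_operad : operad K := Operad end_act_linear end_act1 end_actM
  end_comp_linear end_comp_multilinear end_compA end_compx1 end_comp1x
  end_equivariance.

End EndOperad.

Section LmodQuotient.
Variables (K : fieldType) (V : lmodType K).
Variables (I0 : {pred V}) (I0P : submod_closed I0).

Definition submod_of of submod_closed I0 : {pred V} := I0.
HB.instance Definition _ := GRing.isSubmodClosed.Build K V (submod_of I0P) I0P.
Local Notation I := (submod_of I0P).

Definition quot_scale (a : K) := lift_op1 {ideal_quot I} ( *:%R a).

Lemma pi_scale a : {morph \pi_({ideal_quot I}) : x / a *: x >-> quot_scale a x}.
Proof.
move=> x; unlock quot_scale; apply/eqP; rewrite piE Quotient.equivE.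
by rewrite -scalerBr rpredZ // Quotient.idealrBE reprK.
Qed.

Let pi_addr (x y : V) :
  \pi_({ideal_quot I}) (x + y) = \pi_({ideal_quot I}) x + \pi_({ideal_quot I}) y.
Proof. exact: pi_addr. Qed.

Fact quot_scaleA a b (x : {ideal_quot I}) :
  quot_scale a (quot_scale b x) = quot_scale (a * b) x.
Proof. by rewrite -[x]reprK -!pi_scale scalerA. Qed.
Fact quot_scale1 : left_id 1 quot_scale.
Proof. by move=> x; rewrite -[x]reprK -!pi_scale scale1r. Qed.
Fact quot_scaleDr : right_distributive quot_scale +%R.
Proof.
move=> a x y; rewrite -[x]reprK -[y]reprK -pi_addr -!pi_scale.
by rewrite scalerDr pi_addr.
Qed.
Fact quot_scaleDl (x : {ideal_quot I}) : {morph quot_scale^~ x : a b / a + b}.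
Proof.
by move=> a b; rewrite -[x]reprK -!pi_scale scalerDl pi_addr.
Qed.
HB.instance Definition _ := GRing.Zmodule_isLmodule.Build K {ideal_quot I}
  quot_scaleA quot_scale1 quot_scaleDr quot_scaleDl.

Lemma quot_pi_linear : linear (\pi_({ideal_quot I})).
Proof. by move=> a x y; rewrite pi_addr pi_scale. Qed.

Lemma quot_pi_eq x y : (\pi_({ideal_quot I}) x = \pi_({ideal_quot I}) y) <-> (x - y \in I0).
Proof. by rewrite (Quotient.idealrBE I x y : (x - y \in I0) = _); split => /eqP. Qed.

End LmodQuotient.

Section Ideals.
Variables (K : fieldType) (P : operad K).

Record op_ideal : Type := OpIdeal {
  ideal_pred :> forall n, {pred P n};
  ideal_submod : forall n, submod_closed (@ideal_pred n);
  ideal_act : forall n (x : P n) (s : 'S_n),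
    x \in @ideal_pred n -> op_act x s \in @ideal_pred n;
  ideal_compl : forall n (k : 'I_n -> nat) m (e : (\sum_(i < n) k i)%N = m)
    (x : P n) (y : forall i, P (k i)),
    x \in @ideal_pred n -> op_comp e x y \in @ideal_pred m;
  ideal_compr : forall n (k : 'I_n -> nat) m (e : (\sum_(i < n) k i)%N = m)
    (x : P n) (y : forall i, P (k i)) (i : 'I_n),
    y i \in @ideal_pred (k i) -> op_comp e x y \in @ideal_pred m
}.
Arguments ideal_pred : clear implicits.

Section Generated.
Variable R : forall n, P n -> Prop.

Definition gen_pred n : {pred P n} := fun x : P n =>
  `[< forall I : op_ideal, (forall m (y : P m), R y -> y \in I m) -> x \in I n >].

Arguments gen_pred : clear implicits.

Fact gen_submod n : submod_closed (gen_pred n).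
Proof.
split=> [|a x y /asboolP xI /asboolP yI]; apply/asboolP => I RI.
  by have [] := ideal_submod I n.
by have [_] := ideal_submod I n; apply; [apply: xI | apply: yI].
Qed.
Fact gen_act n (x : P n) (s : 'S_n) :
  x \in gen_pred n -> op_act x s \in gen_pred n.
Proof.
by move=> /asboolP xI; apply/asboolP => I RI; apply/ideal_act/xI.
Qed.
Fact gen_compl n (k : 'I_n -> nat) m (e : (\sum_(i < n) k i)%N = m)
  (x : P n) (y : forall i, P (k i)) :
  x \in gen_pred n -> op_comp e x y \in gen_pred m.
Proof.
by move=> /asboolP xI; apply/asboolP => I RI; apply/ideal_compl/xI.
Qed.
Fact gen_compr n (k : 'I_n -> nat) m (e : (\sum_(i < n) k i)%N = m)
  (x : P n) (y : forall i, P (k i)) (i : 'I_n) :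
  y i \in gen_pred (k i) -> op_comp e x y \in gen_pred m.
Proof.
by move=> /asboolP yI; apply/asboolP => I RI; apply/ideal_compr/yI.
Qed.

Definition gen_ideal : op_ideal :=
  OpIdeal gen_submod gen_act gen_compl gen_compr.

End Generated.

Variable I : op_ideal.

Local Notation ideal_at n := (submod_of (ideal_submod I n)).

Definition quot_sort n : lmodType K := {ideal_quot (ideal_at n)}.

Definition quot_pi n (x : P n) : quot_sort n := \pi_({ideal_quot (ideal_at n)}) x.
Definition quot_repr n (x : quot_sort n) : P n := generic_quotient.repr (x : {ideal_quot (ideal_at n)}).

Lemma quot_reprK n (x : quot_sort n) : quot_pi (quot_repr x) = x.
Proof. exact: reprK. Qed.

Lemma quot_piP n (x y : P n) : quot_pi x = quot_pi y <-> x - y \in I n.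
Proof. exact: quot_pi_eq. Qed.

Lemma quot_piL n : linear (@quot_pi n).
Proof. exact: quot_pi_linear. Qed.

(* The operations of the quotient are computed on representatives; the lemmas
   [quot_pi_act] and [quot_pi_comp] say that they are the induced ones.  *)
Definition quot_act n (x : quot_sort n) (s : 'S_n) : quot_sort n :=
  quot_pi (op_act (quot_repr x) s).
Definition quot_one : quot_sort 1 := quot_pi (op_one P).
Definition quot_comp n (k : 'I_n -> nat) m (e : (\sum_(i < n) k i)%N = m)
    (x : quot_sort n) (y : forall i, quot_sort (k i)) : quot_sort m :=
  quot_pi (op_comp e (quot_repr x) (fun i => quot_repr (y i))).

Lemma quot_pi_act n (x : P n) (s : 'S_n) :
  quot_pi (op_act x s) = quot_act (quot_pi x) s.
Proof.
apply/quot_piP.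
have actB (u v : P n) : op_act u s - op_act v s = op_act (u - v) s.
  have := @op_act_linear K P n s (-1) v u.
  by rewrite /= !scaleN1r ![- _ + _]addrC => <-.
by rewrite actB; apply: ideal_act; apply/quot_piP; rewrite quot_reprK.
Qed.

Lemma quot_pi_comp n (k : 'I_n -> nat) m (e : (\sum_(i < n) k i)%N = m)
    (x : P n) (y : forall i, P (k i)) :
  quot_pi (op_comp e x y) = quot_comp e (quot_pi x) (fun i => quot_pi (y i)).
Proof.
rewrite /quot_comp.
set x' := quot_repr (quot_pi x).
set y' := fun i => quot_repr (quot_pi (y i)).
have yy' i : y i - y' i \in I (k i) by apply/quot_piP; rewrite quot_reprK.
have -> : quot_pi (op_comp e x y) = quot_pi (op_comp e x' y).
  apply/quot_piP.
  have := @op_comp_linear K P n k m e y (-1) x' x.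
  rewrite /= !scaleN1r ![- _ + _]addrC => <-.
  by apply: ideal_compl; apply/quot_piP; rewrite quot_reprK.
pose h t : forall i : 'I_n, P (k i) := fun i => if (i < t)%N then y' i else y i.
have hS t : (t < n)%N ->
    quot_pi (op_comp e x' (h t)) = quot_pi (op_comp e x' (h t.+1)).
  move=> lt_t; pose i : 'I_n := Ordinal lt_t.
  apply/quot_piP.
  pose u : forall j, P (k j) := dfwith (h t) (y i - y' i).
  have -> : op_comp e x' (h t) - op_comp e x' (h t.+1) = op_comp e x' u.
    have /multilinearP eP := @op_comp_multilinear K P n k m e x'.
    rewrite addrC -scaleN1r; apply/esym; apply: (eP i) => [|j ji].
      by rewrite /u dfwith_in scaleN1r /h ltnn ltnSn addrC.
    rewrite /u dfwith_out 1?eq_sym // /h; split=> //.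
    by rewrite (ltnS j t) [(j <= t)%N]leq_eqVlt [j == t :> nat](negbTE ji).
  by apply: (@ideal_compr I n k m e x' u i); rewrite /u dfwith_in; apply: yy'.
have h0n t : (t <= n)%N -> quot_pi (op_comp e x' (h 0)) = quot_pi (op_comp e x' (h t)).
  by elim: t => // t IHt lt_t; rewrite -hS // IHt // ltnW.
rewrite -/(h 0) (h0n n) //; congr (quot_pi (op_comp e x' _)).
by apply: functional_extensionality_dep => i; rewrite /h ltn_ord.
Qed.

Let reprE n (x : quot_sort n) : x = quot_pi (quot_repr x).
Proof. by rewrite quot_reprK. Qed.

Let famE n (k : 'I_n -> nat) (y : forall i, quot_sort (k i)) :
  y = fun i => quot_pi (quot_repr (y i)).
Proof. by apply: functional_extensionality_dep => i; rewrite quot_reprK. Qed.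

Fact quot_act_linear n (s : 'S_n) : linear (fun x => @quot_act n x s).
Proof.
move=> a x y; rewrite (reprE x) (reprE y) -quot_piL -!quot_pi_act.
by rewrite (@op_act_linear K P n s) quot_piL.
Qed.

Fact quot_act1 n (x : quot_sort n) : quot_act x 1%g = x.
Proof. by rewrite (reprE x) -quot_pi_act op_act1. Qed.

Fact quot_actM n (x : quot_sort n) (s t : 'S_n) :
  quot_act (quot_act x s) t = quot_act x (t * s)%g.
Proof. by rewrite (reprE x) -!quot_pi_act op_actM. Qed.

Fact quot_comp_linear n (k : 'I_n -> nat) m (e : (\sum_(i < n) k i)%N = m)
  (y : forall i, quot_sort (k i)) : linear (fun x => quot_comp e x y).
Proof.
move=> a x x'; rewrite (famE y) (reprE x) (reprE x') -quot_piL -!quot_pi_comp.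
by rewrite (@op_comp_linear K P n k m e _) quot_piL.
Qed.

Fact quot_comp_multilinear n (k : 'I_n -> nat) m
  (e : (\sum_(i < n) k i)%N = m) (x : quot_sort n) : multilinear (quot_comp e x).
Proof.
move=> y i a u v; rewrite (reprE x) (famE y) (reprE u) (reprE v) -quot_piL.
have E z : dfwith (fun i => quot_pi (quot_repr (y i))) (quot_pi z) =
    fun j => quot_pi (dfwith (i := i) (fun j => quot_repr (y j)) z j).
  by apply: functional_extensionality_dep => j; case: dfwithP => [|j' ij'];
    rewrite ?dfwith_in ?dfwith_out.
by rewrite !E -!quot_pi_comp op_comp_multilinear quot_piL.
Qed.

Fact quot_compA n (k : 'I_n -> nat) (l : forall i, 'I_(k i) -> nat)
    (r : 'I_n -> nat) m
    (e : forall i, (\sum_(j < k i) l i j)%N = r i)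
    (e1 : (\sum_(i < n) r i)%N = m)
    (e2 : (\sum_(p < \sum_(i < n) k i) l (tagnat.sig1 p) (tagnat.sig2 p))%N = m)
    (x : quot_sort n) (y : forall i, quot_sort (k i))
    (z : forall i j, quot_sort (l i j)) :
  quot_comp e1 x (fun i => quot_comp (e i) (y i) (z i)) =
  quot_comp e2 (quot_comp erefl x y)
            (fun p => z (tagnat.sig1 p) (tagnat.sig2 p)).
Proof.
pose x0 := quot_repr x; pose y0 i := quot_repr (y i).
pose z0 i j := quot_repr (z i j).
have zE : z = fun i j => quot_pi (z0 i j).
  by apply: functional_extensionality_dep => i; apply: famE.
rewrite zE (famE y) (reprE x) -/x0.
transitivity (quot_pi (op_comp e1 x0 (fun i => op_comp (e i) (y0 i) (z0 i)))).
  rewrite quot_pi_comp; congr (quot_comp e1 _ _).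
  by apply: functional_extensionality_dep => i; rewrite quot_pi_comp.
by rewrite (op_compA e e1 e2) 2!quot_pi_comp.
Qed.

Fact quot_compx1 n (e : (\sum_(i < n) 1)%N = n) (x : quot_sort n) :
  quot_comp e x (fun=> quot_one) = x.
Proof. by rewrite (reprE x) -quot_pi_comp op_compx1. Qed.

Fact quot_comp1x n (e : (\sum_(i < 1) n)%N = n) (x : quot_sort n) :
  quot_comp e quot_one (fun=> x) = x.
Proof. by rewrite (reprE x) -quot_pi_comp op_comp1x. Qed.

Fact quot_equivariance n (k : 'I_n -> nat) (s : 'S_n)
    (t : forall i, 'S_(k i)) m
    (e1 : (\sum_(i < n) k (s i))%N = m) (e2 : (\sum_(i < n) k i)%N = m)
    (x : quot_sort n) (y : forall i, quot_sort (k i)) :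
  quot_comp e1 (quot_act x s) (fun i => quot_act (y (s i)) (t (s i))) =
  quot_act (quot_comp e2 x y) (block_perm t e1 e2).
Proof.
rewrite (famE y) (reprE x) -quot_pi_comp -!quot_pi_act.
rewrite -op_equivariance quot_pi_comp; congr (quot_comp e1 _ _).
by apply: functional_extensionality_dep => i; rewrite quot_pi_act.
Qed.

Definition quot_operad : operad K := Operad quot_act_linear quot_act1 quot_actM
  quot_comp_linear quot_comp_multilinear quot_compA quot_compx1 quot_comp1x
  quot_equivariance.

Definition quot_proj : operad_morph P quot_operad :=
  @OperadMorph K P quot_operad quot_pi quot_piL quot_pi_act erefl quot_pi_comp.

End Ideals.

Definition is_free (K : fieldType) (P : nat -> Type) (T : operad K)
    (i : forall n, P n -> T n) : Prop :=
  forall (Q : operad K) (f : forall n, P n -> Q n),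
    exists! g : operad_morph T Q, forall n (p : P n), g n (i n p) = f n p.

Lemma operad_morph_ext (K : fieldType) (P Q : operad K) (f g : operad_morph P Q) :
  (forall n (x : P n), f n x = g n x) -> f = g.
Proof.
case: f g => [f fL fA f1 fC] [g gL gA g1 gC] /= fg.
have E : f = g.
  by apply: functional_extensionality_dep => n; apply: funext => x.
by subst g; congr OperadMorph; apply: Prop_irrelevance.
Qed.

(* The free operad consists of formal operadic expressions in the generators,
   two expressions being identified when they agree under all evaluations in
   all operads; [free_operadP] is its universal property.  *)
Section FreeOperad.
Variables (K : fieldType) (P : nat -> Type).

Inductive op_term : nat -> Type :=
| TGen n of P n : op_term n
| TZero n : op_term n
| TAdd n of op_term n & op_term n : op_term n
| TScale n of K & op_term n : op_term n
| TAct n of op_term n & 'S_n : op_term n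
| TOne : op_term 1
| TComp n (k : 'I_n -> nat) m of (\sum_(i < n) k i)%N = m & op_term n
    & (forall i, op_term (k i)) : op_term m.

Fixpoint term_eval (Q : operad K) (f : forall n, P n -> Q n) n (t : op_term n) :
    Q n :=
  match t with
  | TGen _ p => f _ p
  | TZero _ => 0
  | TAdd _ t1 t2 => term_eval f t1 + term_eval f t2
  | TScale _ a t1 => a *: term_eval f t1
  | TAct _ t1 s => op_act (term_eval f t1) s
  | TOne => op_one Q
  | TComp _ _ _ e t1 t2 =>
      op_comp e (term_eval f t1) (fun i => term_eval f (t2 i))
  end.

Definition term_eq n (t u : {classic op_term n}) : bool :=
  `[< forall (Q : operad K) (f : forall n, P n -> Q n),
        term_eval f t = term_eval f u >].

Fact term_eq_equiv n : equiv_class_of (@term_eq n).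
Proof.
split=> [t|t u|u t v].
- by apply/asboolP.
- by apply/asboolP/asboolP => E Q f; rewrite E.
- by move=> /asboolP E /asboolP E'; apply/asboolP => Q f; rewrite E E'.
Qed.
Canonical term_equiv n := EquivRelPack (@term_eq_equiv n).

Definition free_sort n := {eq_quot @term_equiv n}.
HB.instance Definition _ n := Choice.on (free_sort n).
HB.instance Definition _ n := EqQuotient.on (free_sort n).

Definition fpi n (t : op_term n) : free_sort n :=
  \pi_(free_sort n) (t : {classic op_term n}).
Definition frep n (x : free_sort n) : op_term n := generic_quotient.repr x.

Definition free_eval (Q : operad K) (f : forall n, P n -> Q n) n
    (x : free_sort n) : Q n := term_eval f (frep x).

Lemma fpi_eq n (t u : op_term n) :
  (forall (Q : operad K) (f : forall n, P n -> Q n),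
     term_eval f t = term_eval f u) -> fpi t = fpi u.
Proof. by move=> E; apply/eqmodP/asboolP. Qed.

Lemma free_evalE (Q : operad K) (f : forall n, P n -> Q n) n (t : op_term n) :
  free_eval f (fpi t) = term_eval f t.
Proof.
suff /asboolP : term_equiv n (frep (fpi t)) t by apply.
by apply/eqmodP; rewrite reprK.
Qed.

Lemma free_ext n (x y : free_sort n) :
  (forall (Q : operad K) (f : forall n, P n -> Q n),
     free_eval f x = free_eval f y) -> x = y.
Proof. by move=> E; rewrite -[x]reprK -[y]reprK; apply: fpi_eq. Qed.

Definition free_zero n : free_sort n := fpi (TZero n).
Definition free_add n (x y : free_sort n) := fpi (TAdd (frep x) (frep y)).
Definition free_scale n a (x : free_sort n) := fpi (TScale a (frep x)).
Definition free_opp n (x : free_sort n) := free_scale (-1) x.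
Definition free_act n (x : free_sort n) (s : 'S_n) := fpi (TAct (frep x) s).
Definition free_one : free_sort 1 := fpi TOne.
Definition free_comp n (k : 'I_n -> nat) m (e : (\sum_(i < n) k i)%N = m)
    (x : free_sort n) (y : forall i, free_sort (k i)) : free_sort m :=
  fpi (TComp e (frep x) (fun i => frep (y i))).

Section Eval.
Variables (Q : operad K) (f : forall n, P n -> Q n).
Lemma eval_zero n : free_eval f (free_zero n) = 0.
Proof. by rewrite free_evalE. Qed.
Lemma eval_add n (x y : free_sort n) :
  free_eval f (free_add x y) = free_eval f x + free_eval f y.
Proof. by rewrite free_evalE. Qed.
Lemma eval_scale n a (x : free_sort n) :
  free_eval f (free_scale a x) = a *: free_eval f x.
Proof. by rewrite free_evalE. Qed.
Lemma eval_opp n (x : free_sort n) :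
  free_eval f (free_opp x) = - free_eval f x.
Proof. by rewrite eval_scale scaleN1r. Qed.
Lemma eval_act n (x : free_sort n) (s : 'S_n) :
  free_eval f (free_act x s) = op_act (free_eval f x) s.
Proof. by rewrite free_evalE. Qed.
Lemma eval_one : free_eval f free_one = op_one Q.
Proof. by rewrite free_evalE. Qed.
Lemma eval_comp n (k : 'I_n -> nat) m (e : (\sum_(i < n) k i)%N = m)
    (x : free_sort n) (y : forall i, free_sort (k i)) :
  free_eval f (free_comp e x y) =
  op_comp e (free_eval f x) (fun i => free_eval f (y i)).
Proof. by rewrite free_evalE. Qed.
End Eval.

Fact free_addA n : associative (@free_add n).
Proof. by move=> x y z; apply: free_ext => Q f; rewrite !eval_add addrA. Qed.
Fact free_addC n : commutative (@free_add n).
Proof. by move=> x y; apply: free_ext => Q f; rewrite !eval_add addrC. Qed.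
Fact free_add0 n : left_id (free_zero n) (@free_add n).
Proof.
by move=> x; apply: free_ext => Q f; rewrite eval_add eval_zero add0r.
Qed.
Fact free_addN n : left_inverse (free_zero n) (@free_opp n) (@free_add n).
Proof.
by move=> x; apply: free_ext => Q f; rewrite eval_add eval_opp eval_zero addNr.
Qed.
HB.instance Definition _ n := GRing.isZmodule.Build (free_sort n)
  (@free_addA n) (@free_addC n) (@free_add0 n) (@free_addN n).

Fact free_scaleA n a b (x : free_sort n) :
  free_scale a (free_scale b x) = free_scale (a * b) x.
Proof. by apply: free_ext => Q f; rewrite !eval_scale scalerA. Qed.
Fact free_scale1 n : left_id 1 (@free_scale n).
Proof. by move=> x; apply: free_ext => Q f; rewrite eval_scale scale1r. Qed.
Fact free_scaleDr n : right_distributive (@free_scale n) +%R.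
Proof.
move=> a x y; apply: free_ext => Q f.
by rewrite !(eval_scale, eval_add) scalerDr.
Qed.
Fact free_scaleDl n (x : free_sort n) : {morph (@free_scale n)^~ x : a b / a + b}.
Proof.
move=> a b; apply: free_ext => Q f.
by rewrite !(eval_scale, eval_add) scalerDl.
Qed.
HB.instance Definition _ n := GRing.Zmodule_isLmodule.Build K (free_sort n)
  (@free_scaleA n) (@free_scale1 n) (@free_scaleDr n) (@free_scaleDl n).

Definition free_space n : lmodType K := free_sort n.

Lemma eval_linear (Q : operad K) (f : forall n, P n -> Q n) n :
  linear (fun x : free_space n => free_eval f x).
Proof. by move=> a x y; rewrite eval_add eval_scale. Qed.

Fact free_act_linear n (s : 'S_n) :
  linear (fun x : free_space n => free_act x s : free_space n).
Proof.
move=> a x y; apply: free_ext => Q f.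
by rewrite !(eval_linear, eval_act) (@op_act_linear K Q n s).
Qed.
Fact free_act1 n (x : free_space n) : free_act x 1%g = x.
Proof. by apply: free_ext => Q f; rewrite eval_act op_act1. Qed.
Fact free_actM n (x : free_space n) (s t : 'S_n) :
  free_act (free_act x s) t = free_act x (t * s)%g.
Proof. by apply: free_ext => Q f; rewrite !eval_act op_actM. Qed.
Fact free_comp_linear n (k : 'I_n -> nat) m (e : (\sum_(i < n) k i)%N = m)
    (y : forall i, free_space (k i)) :
  linear (fun x : free_space n => free_comp e x y : free_space m).
Proof.
move=> a x x'; apply: free_ext => Q f.
by rewrite !(eval_linear, eval_comp) (@op_comp_linear K Q n k m e _).
Qed.
Fact free_comp_multilinear n (k : 'I_n -> nat) m
    (e : (\sum_(i < n) k i)%N = m) (x : free_space n) :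
  @multilinear K n (fun i => free_space (k i)) (free_space m) (free_comp e x).
Proof.
move=> y i a u v; apply: free_ext => Q f.
have E z : (fun j => free_eval f (dfwith (T := fun i => free_space (k i)) y z j)) =
    dfwith (fun j => free_eval f (y j)) (i := i) (free_eval f z).
  by apply: functional_extensionality_dep => j; case: dfwithP => [|j' ij'];
    rewrite ?dfwith_in ?dfwith_out.
by rewrite !(eval_linear, eval_comp) !E eval_linear op_comp_multilinear.
Qed.
Fact free_compA n (k : 'I_n -> nat) (l : forall i, 'I_(k i) -> nat)
    (r : 'I_n -> nat) m
    (e : forall i, (\sum_(j < k i) l i j)%N = r i)
    (e1 : (\sum_(i < n) r i)%N = m)
    (e2 : (\sum_(p < \sum_(i < n) k i) l (tagnat.sig1 p) (tagnat.sig2 p))%N = m)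
    (x : free_space n) (y : forall i, free_space (k i))
    (z : forall i j, free_space (l i j)) :
  free_comp e1 x (fun i => free_comp (e i) (y i) (z i)) =
  free_comp e2 (free_comp erefl x y)
            (fun p => z (tagnat.sig1 p) (tagnat.sig2 p)).
Proof.
apply: free_ext => Q f; rewrite !eval_comp.
under [X in op_comp e1 _ X]functional_extensionality_dep do rewrite eval_comp.
by rewrite (op_compA e e1 e2 _ _ (fun i j => free_eval f (z i j))).
Qed.
Fact free_compx1 n (e : (\sum_(i < n) 1)%N = n) (x : free_space n) :
  free_comp e x (fun=> free_one) = x.
Proof. by apply: free_ext => Q f; rewrite eval_comp eval_one op_compx1. Qed.
Fact free_comp1x n (e : (\sum_(i < 1) n)%N = n) (x : free_space n) :
  free_comp e free_one (fun=> x) = x.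
Proof. by apply: free_ext => Q f; rewrite eval_comp eval_one op_comp1x. Qed.
Fact free_equivariance n (k : 'I_n -> nat) (s : 'S_n)
    (t : forall i, 'S_(k i)) m
    (e1 : (\sum_(i < n) k (s i))%N = m) (e2 : (\sum_(i < n) k i)%N = m)
    (x : free_space n) (y : forall i, free_space (k i)) :
  free_comp e1 (free_act x s) (fun i => free_act (y (s i)) (t (s i))) =
  free_act (free_comp e2 x y) (block_perm t e1 e2).
Proof.
apply: free_ext => Q f; rewrite eval_act !eval_comp eval_act -op_equivariance.
congr (op_comp e1 _ _); apply: functional_extensionality_dep => i.
by rewrite eval_act.
Qed.

Definition free_operad : operad K := @Operad K free_space free_act free_one
  free_comp free_act_linear free_act1 free_actM free_comp_linear
  free_comp_multilinear free_compA free_compx1 free_comp1x free_equivariance.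

Definition free_gen n (p : P n) : free_operad n := fpi (TGen p).

Theorem free_operadP : is_free free_gen.
Proof.
move=> Q f.
exists (@OperadMorph K free_operad Q (@free_eval Q f) (@eval_linear Q f)
  (@eval_act Q f) (eval_one f) (@eval_comp Q f)).
split=> [n p|g gP]; first by rewrite /= free_evalE.
apply: operad_morph_ext => n x /=; rewrite -[x]reprK; move: (generic_quotient.repr x).
rewrite -/(fpi _) => t; rewrite [LHS]free_evalE.
have gD n' (u v : free_operad n') : g n' (u + v) = g n' u + g n' v.
  by have := @mor_linear K free_operad Q g n' 1 u v; rewrite !scale1r.
have g0 n' : g n' (0 : free_operad n') = 0.
  by apply: (addrI (g n' 0)); rewrite -gD !addr0.
have gZ n' a (u : free_operad n') : g n' (a *: u) = a *: g n' u.
  by have := @mor_linear K free_operad Q g n' a u 0; rewrite g0 !addr0.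
elim: t => {n x} [n p|n|n t IHt u IHu|n a t IHt|n t IHt s||n k m e t IHt u IHu] /=.
- by rewrite -gP.
- by rewrite -(g0 n).
- rewrite IHt IHu -gD; congr (g n _).
  by apply: free_ext => R h; rewrite eval_add !free_evalE.
- rewrite IHt -gZ; congr (g n _).
  by apply: free_ext => R h; rewrite eval_scale !free_evalE.
- rewrite IHt -mor_act; congr (g n _).
  by apply: free_ext => R h; rewrite eval_act !free_evalE.
- by rewrite -(mor_one g).
- under [X in op_comp e _ X]functional_extensionality_dep do rewrite IHu.
  rewrite IHt -mor_comp; congr (g m _).
  apply: free_ext => R h; rewrite eval_comp !free_evalE /=; congr op_comp.
  by apply: functional_extensionality_dep => i; rewrite free_evalE.
Qed.

End FreeOperad.

Section Pair.
Variables (a b m : nat) (e : (a + b)%N = m).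

Definition pair_arity (i : 'I_2) : nat := if i == ord0 then a else b.

Lemma pair_arityE : (\sum_(i < 2) pair_arity i)%N = m.
Proof. by rewrite big_ord_recl big_ord1 /= -e. Qed.

(* the composite x o (y, z) for x of arity 2 *)
Definition op_comp2 (K : fieldType) (P : operad K) (x : P 2) (y : P a) (z : P b)
    : P m :=
  op_comp pair_arityE x
    (fun i => if i == ord0 as c return P (if c then a else b) then y else z).

End Pair.

Section Lie.
Variable K : fieldType.

Inductive lie_gen : nat -> Type := lie_bracket_gen : lie_gen 2.

Definition lie_free : operad K := free_operad K lie_gen.
Definition lie_free_ell : lie_free 2 := free_gen K lie_bracket_gen.

(* 0 -> 1 -> 2 -> 0, the permutation 1 -> 2 -> 3 -> 1 on indices from 0 *)
Definition cycle3 : 'S_3 := perm (@ordS_inj 3).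

Inductive lie_rel : forall n, lie_free n -> Prop :=
| LieAntisym :
    lie_rel (lie_free_ell + op_act lie_free_ell (tperm ord0 ord_max))
| LieJacobi (j := op_comp2 (erefl : 2 + 1 = 3)%N
                    lie_free_ell lie_free_ell (op_one lie_free)) :
    lie_rel (j + op_act j cycle3 + op_act j (cycle3 ^+ 2)%g).

Definition Lie : operad K := quot_operad (gen_ideal lie_rel).
Definition ell : Lie 2 := quot_proj (gen_ideal lie_rel) 2 lie_free_ell.

End Lie.

Record category : Type := Category {
  ob :> Type;
  hom : ob -> ob -> Type;
  idh : forall X, hom X X;
  comph : forall X Y Z, hom Y Z -> hom X Y -> hom X Z;
  comp_idl : forall X Y (f : hom X Y), comph (idh Y) f = f;
  comp_idr : forall X Y (f : hom X Y), comph f (idh X) = f;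
  comp_assoc : forall X Y Z T (h : hom Z T) (g : hom Y Z) (f : hom X Y),
    comph h (comph g f) = comph (comph h g) f
}.
Arguments hom {c} X Y.
Arguments idh {c} X.

Record functor (C D : category) : Type := Functor {
  fob :> C -> D;
  fmap : forall X Y, hom X Y -> hom (fob X) (fob Y);
  fmap_id : forall X, fmap (idh X) = idh (fob X);
  fmap_comp : forall X Y Z (g : hom Y Z) (f : hom X Y),
    fmap (comph g f) = comph (fmap g) (fmap f)
}.
Arguments fmap {C D} F [X Y] f : rename.

Definition functor_id (C : category) : functor C C :=
  @Functor C C id (fun _ _ f => f) (fun=> erefl) (fun _ _ _ _ _ => erefl).

Section FunctorComp.
Variables (C D E : category) (G : functor D E) (F : functor C D).
Fact functor_comp_id X : fmap G (fmap F (idh X)) = idh (G (F X)).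
Proof. by rewrite !fmap_id. Qed.
Fact functor_comp_comp X Y Z (g : hom Y Z) (f : hom X Y) :
  fmap G (fmap F (comph g f)) = comph (fmap G (fmap F g)) (fmap G (fmap F f)).
Proof. by rewrite !fmap_comp. Qed.
Definition functor_comp : functor C E :=
  @Functor C E (fun X => G (F X)) (fun X Y f => fmap G (fmap F f))
    functor_comp_id functor_comp_comp.
End FunctorComp.

(* [F] and [G] are mutually inverse isomorphisms of categories: the composite
   functors are equal, and not just naturally isomorphic, to the identities *)
Definition inverse_functors (C D : category) (F : functor C D) (G : functor D C)
    : Prop :=
  functor_comp G F = functor_id C /\ functor_comp F G = functor_id D.

Section Algebras.
Variables (K : fieldType) (P : operad K).

Record op_alg : Type := OpAlg {
  alg_sort :> lmodType K;
  alg_op : operad_morph P (end_operad alg_sort)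
}.

Record alg_hom (A B : op_alg) : Type := AlgHom {
  alg_fun :> A -> B;
  alg_hom_linear : linear alg_fun;
  alg_homP : forall n (x : P n) (v : 'I_n -> A),
    alg_fun ((alg_op A n x : end_space A n) v) =
    (alg_op B n x : end_space B n) (fun i => alg_fun (v i))
}.

Lemma alg_hom_ext (A B : op_alg) (f g : alg_hom A B) : f =1 g -> f = g.
Proof.
case: f g => [f fL fP] [g gL gP] /= /funext E; subst g.
by congr AlgHom; apply: Prop_irrelevance.
Qed.

Definition alg_id (A : op_alg) : alg_hom A A :=
  @AlgHom A A id (fun _ _ _ => erefl) (fun _ _ _ => erefl).

Section Comp.
Variables (A B C : op_alg) (g : alg_hom B C) (f : alg_hom A B).
Fact alg_comp_linear : linear (g \o f).
Proof. by move=> a x y /=; rewrite !alg_hom_linear. Qed.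
Fact alg_compP n (x : P n) (v : 'I_n -> A) :
  (g \o f) ((alg_op A n x : end_space A n) v) =
  (alg_op C n x : end_space C n) (fun i => (g \o f) (v i)).
Proof. by rewrite /= !alg_homP. Qed.
Definition alg_comp : alg_hom A C := AlgHom alg_comp_linear alg_compP.
End Comp.

Fact alg_comp_idl A B (f : alg_hom A B) : alg_comp (alg_id B) f = f.
Proof. exact: alg_hom_ext. Qed.
Fact alg_comp_idr A B (f : alg_hom A B) : alg_comp f (alg_id A) = f.
Proof. exact: alg_hom_ext. Qed.
Fact alg_comp_assoc A B C D (h : alg_hom C D) (g : alg_hom B C) (f : alg_hom A B) :
  alg_comp h (alg_comp g f) = alg_comp (alg_comp h g) f.
Proof. exact: alg_hom_ext. Qed.

Definition Alg : category := Category alg_comp_idl alg_comp_idr alg_comp_assoc.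

End Algebras.

Section LieAlgebras.
Variable K : fieldType.

Definition is_lie_bracket (V : lmodType K) (br : V -> V -> V) : Prop :=
  [/\ forall x, linear (br x),
      forall y, linear (br ^~ y),
      forall x, br x x = 0
    & forall x y z, br x (br y z) + br y (br z x) + br z (br x y) = 0].

Record lie_alg : Type := LieAlgebra {
  lie_sort :> lmodType K;
  bracket : lie_sort -> lie_sort -> lie_sort;
  bracketP : is_lie_bracket bracket
}.

Record lie_hom (g h : lie_alg) : Type := LieHom {
  lie_fun :> g -> h;
  lie_hom_linear : linear lie_fun;
  lie_homP : forall x y, lie_fun (bracket x y) = bracket (lie_fun x) (lie_fun y)
}.

Lemma lie_hom_ext (g h : lie_alg) (f f' : lie_hom g h) : f =1 f' -> f = f'.
Proof.
case: f f' => [f fL fP] [f' gL gP] /= /funext E; subst f'.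
by congr LieHom; apply: Prop_irrelevance.
Qed.

Definition lie_id (g : lie_alg) : lie_hom g g :=
  @LieHom g g id (fun _ _ _ => erefl) (fun _ _ => erefl).

Section Comp.
Variables (g h k : lie_alg) (f' : lie_hom h k) (f : lie_hom g h).
Fact lie_comp_linear : linear (f' \o f).
Proof. by move=> a x y /=; rewrite !lie_hom_linear. Qed.
Fact lie_compP x y : (f' \o f) (bracket x y) = bracket ((f' \o f) x) ((f' \o f) y).
Proof. by rewrite /= !lie_homP. Qed.
Definition lie_comp : lie_hom g k := LieHom lie_comp_linear lie_compP.
End Comp.

Fact lie_comp_idl g h (f : lie_hom g h) : lie_comp (lie_id h) f = f.
Proof. exact: lie_hom_ext. Qed.
Fact lie_comp_idr g h (f : lie_hom g h) : lie_comp f (lie_id g) = f.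
Proof. exact: lie_hom_ext. Qed.
Fact lie_comp_assoc g h k l (f'' : lie_hom k l) (f' : lie_hom h k)
    (f : lie_hom g h) :
  lie_comp f'' (lie_comp f' f) = lie_comp (lie_comp f'' f') f.
Proof. exact: lie_hom_ext. Qed.

Definition LieAlg : category := Category lie_comp_idl lie_comp_idr lie_comp_assoc.

End LieAlgebras.

(* an element of Hom(V (x) V, V) as a binary operation *)
Definition binop (K : fieldType) (V : lmodType K) (f : end_space V 2) (x y : V) : V :=
  f (fun i => if i == ord0 then x else y).

Definition lie_op (K : fieldType) (V : lmodType K)
    (Phi : operad_morph (Lie K) (end_operad V)) : V -> V -> V :=
  binop (Phi 2 (ell K)).

(* A map together with its source and target, to state that maps between
   provably equal spaces are the same.  *)
Definition map_of (K : fieldType) (V W : lmodType K) (f : V -> W) :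
    {p : lmodType K * lmodType K & p.1 -> p.2} :=
  existT (fun p : lmodType K * lmodType K => p.1 -> p.2) (V, W) f.

(* Main.v *)
(* A Lie-algebra structure on [V] and an operad morphism [Lie -> End_V] carry
   the same data: a morphism out of the free operad is a choice of binary
   operation, and it kills the two relations exactly when that operation is a
   Lie bracket, where characteristic [<> 2] turns [[x,y] = - [y,x]] into
   [[x,x] = 0].  Every element of [Lie] is an operadic expression in [ell], so
   a map compatible with the brackets is compatible with all operations.  *)
Require Import Defs.
From HB Require Import structures.
From mathcomp Require Import all_boot all_order all_algebra all_fingroup.
From mathcomp Require Import boolp.

Set Implicit Arguments.
Unset Strict Implicit.
Unset Printing Implicit Defensive.

Import GRing.Theory.
Local Open Scope ring_scope.

(** * Kernels of operad morphisms and factorization through quotients *)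

Section Morphisms.
Variables (K : fieldType) (P Q : operad K) (g : operad_morph P Q).

Lemma mor0 n : g n 0 = 0.
Proof.
by have := mor_linear g (n := n) (-1) 0 0; rewrite scaler0 addr0 scaleN1r addNr.
Qed.

Lemma morD n (x y : P n) : g n (x + y) = g n x + g n y.
Proof. by rewrite -[x]scale1r mor_linear !scale1r. Qed.

Lemma morZ n a (x : P n) : g n (a *: x) = a *: g n x.
Proof. by rewrite -[a *: x]addr0 mor_linear mor0 addr0. Qed.

Lemma mor_op_comp2 a b m (e : (a + b)%N = m) (x : P 2) (y : P a) (z : P b) :
  g m (op_comp2 e x y z) = op_comp2 e (g 2 x) (g a y) (g b z).
Proof.
rewrite /op_comp2 mor_comp; congr op_comp.
by apply: functional_extensionality_dep => -[[|[|//]] lti].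
Qed.

Definition ker_pred n : {pred P n} := fun x => g n x == 0.

Fact ker_submod n : submod_closed (@ker_pred n).
Proof.
split=> [|a x y /eqP gx /eqP gy]; first by apply/eqP/mor0.
by apply/eqP; rewrite mor_linear gx gy scaler0 addr0.
Qed.

Fact ker_act n (x : P n) (s : 'S_n) :
  x \in @ker_pred n -> op_act x s \in @ker_pred n.
Proof.
move=> /eqP gx; apply/eqP; rewrite mor_act gx.
have := @op_act_linear K Q n s (-1) 0 0.
by rewrite /= !scaleN1r oppr0 addr0 addNr.
Qed.

Fact ker_compl n (k : 'I_n -> nat) m (e : (\sum_(i < n) k i)%N = m)
    (x : P n) (y : forall i, P (k i)) :
  x \in @ker_pred n -> op_comp e x y \in @ker_pred m.
Proof.
move=> /eqP gx; apply/eqP; rewrite mor_comp gx.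
have := @op_comp_linear K Q n k m e (fun i => g (k i) (y i)) (-1) 0 0.
by rewrite /= !scaleN1r oppr0 addr0 addNr.
Qed.

Fact ker_compr n (k : 'I_n -> nat) m (e : (\sum_(i < n) k i)%N = m)
    (x : P n) (y : forall i, P (k i)) (i : 'I_n) :
  y i \in @ker_pred (k i) -> op_comp e x y \in @ker_pred m.
Proof.
move=> /eqP gy; apply/eqP; rewrite mor_comp.
(* Multilinearity in slot [i] is applied with all three families equal: as the [i]-th entry is
   [0 = -1 *: 0 + 0], the composite equals minus itself plus itself. *)
have /multilinearP/(_ i (-1)) := @op_comp_multilinear K Q n k m e (g n x).
set v := fun i => _; move=> /(_ v v v) ->; last by [].
  by rewrite scaleN1r addNr.
by rewrite /v gy scaler0 addr0.
Qed.

Definition ker_ideal : op_ideal P :=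
  OpIdeal ker_submod ker_act ker_compl ker_compr.

(** The kernel is itself an operadic ideal, hence one of those over which [gen_ideal] quantifies. *)
Lemma ker_gen_ideal (R : forall n, P n -> Prop) :
  (forall n (x : P n), R n x -> g n x = 0) ->
  forall n (x : P n), x \in ideal_pred (gen_ideal R) (n := n) -> g n x = 0.
Proof.
by move=> gR n x /asboolP/(_ ker_ideal) xI; apply/eqP/xI => m y /gR/eqP.
Qed.

Section Lift.
Variables (I : op_ideal P).
Hypothesis gI : forall n (x : P n), x \in I n -> g n x = 0.

Definition lift_fun n (x : quot_operad I n) : Q n := g n (quot_repr x).

(** Independence of the representative: the chosen one differs from [x] by an element of [I], which
    [g] kills. *)
Lemma lift_fun_pi n (x : P n) : lift_fun (quot_proj I n x) = g n x.
Proof.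
have /quot_piP/gI := quot_reprK (quot_pi I x).
by rewrite morD -scaleN1r morZ scaleN1r => /eqP; rewrite subr_eq0 => /eqP.
Qed.

Lemma quot_projK n (x : quot_operad I n) : quot_proj I n (quot_repr x) = x.
Proof. exact: quot_reprK. Qed.

Fact lift_linear n : linear (@lift_fun n).
Proof.
move=> a x y; rewrite -[x in LHS]quot_projK -[y in LHS]quot_projK.
by rewrite -mor_linear lift_fun_pi mor_linear.
Qed.

Fact lift_act n (x : quot_operad I n) (s : 'S_n) :
  lift_fun (op_act x s) = op_act (lift_fun x) s.
Proof. by rewrite -[x in LHS]quot_projK -mor_act lift_fun_pi mor_act. Qed.

Fact lift_one : lift_fun (op_one (quot_operad I)) = op_one Q.
Proof. by rewrite -(mor_one (quot_proj I)) lift_fun_pi mor_one. Qed.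

Fact lift_comp n (k : 'I_n -> nat) m (e : (\sum_(i < n) k i)%N = m)
    (x : quot_operad I n) (y : forall i, quot_operad I (k i)) :
  lift_fun (op_comp e x y) = op_comp e (lift_fun x) (fun i => lift_fun (y i)).
(* By definition [quot_comp] is the class of a composite of representatives, so [lift_fun_pi]
   applies directly. *)
Proof. by rewrite lift_fun_pi mor_comp. Qed.

Definition lift_morph : operad_morph (quot_operad I) Q :=
  OperadMorph lift_linear lift_act lift_one lift_comp.

End Lift.
End Morphisms.

(** * Structural induction in free operads and in [Lie] *)

Lemma free_ind (K : fieldType) (G : nat -> Type)
    (S : forall n, free_operad K G n -> Prop) :
  (forall n (p : G n), S n (free_gen K p)) ->
  (forall n, S n 0) ->
  (forall n x y, S n x -> S n y -> S n (x + y)) ->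
  (forall n a x, S n x -> S n (a *: x)) ->
  (forall n x s, S n x -> S n (op_act x s)) ->
  S 1 (op_one (free_operad K G)) ->
  (forall n (k : 'I_n -> nat) m (e : (\sum_(i < n) k i)%N = m) x
      (y : forall i, free_operad K G (k i)),
     S n x -> (forall i, S (k i) (y i)) -> S m (op_comp e x y)) ->
  forall n x, S n x.
Proof.
move=> SG S0 SD SZ SA S1 SC n x; rewrite -[x]generic_quotient.reprK.
move: (generic_quotient.repr x) => /= t; rewrite -/(fpi t).
(* The class of each compound expression is the corresponding operation on classes, because both
   evaluate alike in every operad. *)
elim: t => {n x}
  [n p|n|n t St u Su|n a t St|n t St s||n k m e t St u Su]; first exact: SG.
- exact: S0.
- suff -> : fpi (TAdd t u) = (fpi t : free_operad K G n) + fpi u by exact: SD.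
  by apply: free_ext => Q f; rewrite eval_add !free_evalE.
- suff -> : fpi (TScale a t) = a *: (fpi t : free_operad K G n) by exact: SZ.
  by apply: free_ext => Q f; rewrite eval_scale !free_evalE.
- suff -> : fpi (TAct t s) = op_act (fpi t : free_operad K G n) s by exact: SA.
  by apply: free_ext => Q f; rewrite eval_act !free_evalE.
- exact: S1.
- suff -> : fpi (TComp e t u) =
      op_comp e (fpi t : free_operad K G n) (fun i => fpi (u i)) by exact: SC.
  apply: free_ext => Q f; rewrite eval_comp !free_evalE /=; congr op_comp.
  by apply: functional_extensionality_dep => i; rewrite free_evalE.
Qed.

(** The projection from the free operad is a surjective morphism, so [S] is pulled back along it and
    [free_ind] applies. *)
Lemma Lie_ind (K : fieldType) (S : forall n, Lie K n -> Prop) :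
  S 2 (ell K) ->
  (forall n, S n 0) ->
  (forall n x y, S n x -> S n y -> S n (x + y)) ->
  (forall n a x, S n x -> S n (a *: x)) ->
  (forall n x s, S n x -> S n (op_act x s)) ->
  S 1 (op_one (Lie K)) ->
  (forall n (k : 'I_n -> nat) m (e : (\sum_(i < n) k i)%N = m) x
      (y : forall i, Lie K (k i)),
     S n x -> (forall i, S (k i) (y i)) -> S m (op_comp e x y)) ->
  forall n x, S n x.
Proof.
move=> Sell S0 SD SZ SA S1 SC n x; rewrite -[x]quot_projK.
move: (quot_repr x) => {x}; set q := quot_proj _; move: n.
apply: free_ind => [n []|n|n x y Sx Sy|n a x Sx|n x s Sx||n k m e x y Sx Sy].
- exact: Sell.
- by rewrite mor0.
- by rewrite morD; apply: SD.
- by rewrite morZ; apply: SZ.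
- by rewrite mor_act; apply: SA.
- exact: S1.
- by rewrite mor_comp; apply: SC.
Qed.

(** The elements on which two morphisms agree are closed under all operations, and [ell] generates
    [Lie]. *)
Lemma Lie_morph_ext (K : fieldType) (Q : operad K)
    (f g : operad_morph (Lie K) Q) :
  f 2 (ell K) = g 2 (ell K) -> f = g.
Proof.
move=> fg; apply: operad_morph_ext.
apply: Lie_ind => // [n|n x y|n a x|n x s||n k m e x y] => *.
- by rewrite !mor0.
- by rewrite !morD; congr (_ + _).
- by rewrite !morZ; congr (_ *: _).
- by rewrite !mor_act; congr op_act.
- by rewrite !mor_one.
- by rewrite !mor_comp; congr op_comp => //; apply: functional_extensionality_dep.
Qed.

(** * The two Lie relations read in an endomorphism operad *)

Section EndRelations.
Variables (K : fieldType) (V : lmodType K).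
Local Notation E := (end_operad V).

(** The two blocks start at offsets [0] and [a], which is where [lshift] and [rshift] put them. *)
Lemma end_comp2E a b m (e : (a + b)%N = m) (f : E 2) (y : E a) (z : E b)
    (v : 'I_m -> V) :
  (op_comp2 e f y z : end_space V m) v =
  binop f ((y : end_space V a) (fun j => v (cast_ord e (lshift b j))))
          ((z : end_space V b) (fun j => v (cast_ord e (rshift a j)))).
Proof.
congr ((f : end_space V 2) _); apply: funext => -[[|[|//]] lti] /=.
  congr ((y : end_space V a) _); apply: funext => j; congr v.
  by apply: ord_inj; rewrite val_cast_Rank big1 // => -[[]].
congr ((z : end_space V b) _); apply: funext => j; congr v.
apply: ord_inj; rewrite val_cast_Rank /= big_mkcond big_ord_recl big_ord1 /=.
by rewrite addn0.
Qed.

Lemma end_tpermE (f : E 2) (v : 'I_2 -> V) :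
  (op_act f (tperm ord0 ord_max) : end_space V 2) v = binop f (v ord_max) (v ord0).
Proof.
congr ((f : end_space V 2) _); apply: funext => i; rewrite tpermV.
by case: i => [[|[|//]] lti]; [rewrite (_ : Ordinal _ = ord0) ?tpermL
  |rewrite (_ : Ordinal _ = ord_max) ?tpermR] => //; apply: ord_inj.
Qed.

Lemma binop_eta (f : E 2) (v : 'I_2 -> V) :
  (f : end_space V 2) v = binop f (v ord0) (v ord_max).
Proof.
by congr ((f : end_space V 2) _); apply: funext => -[[|[|//]] lti];
  congr v; apply: ord_inj.
Qed.

Lemma end_antisymP (f : E 2) :
  f + op_act f (tperm ord0 ord_max) = 0 <->
  forall x y, binop f x y + binop f y x = 0.
Proof.
split=> [f0 x y|f0].
  transitivity (binop (f + op_act f (tperm ord0 ord_max) : E 2) x y).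
    by congr (_ + _); apply: esym; apply: end_tpermE.
  by rewrite f0.
apply: (@end_ext K V 2) => v.
by rewrite -[RHS](f0 (v ord0) (v ord_max)) -end_tpermE -binop_eta.
Qed.

(** The action permutes arguments by the inverse permutation; the inverses of [cycle3] and of its
    square turn [(x, y, z)] into [(z, x, y)] and [(y, z, x)]. *)
Lemma end_jacobiP (f : E 2)
    (j := op_comp2 (erefl : 2 + 1 = 3)%N f f (op_one E)) :
  j + op_act j cycle3 + op_act j (cycle3 ^+ 2)%g = 0 <->
  forall x y z, binop f (binop f x y) z + binop f (binop f z x) y
                + binop f (binop f y z) x = 0.
Proof.
pose o1 : 'I_3 := lift ord0 ord0; pose o2 : 'I_3 := ord_max.
have jE (v : 'I_3 -> V) : (j : end_space V 3) v =
    binop f (binop f (v ord0) (v o1)) (v o2).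
  rewrite end_comp2E binop_eta.
  by congr (binop f (binop f (v _) (v _)) (v _)); apply: ord_inj.
have c0 : cycle3^-1%g ord0 = o2.
  by apply: (@perm_inj _ cycle3); rewrite permKV permE; apply: ord_inj.
have c1 : cycle3^-1%g o1 = ord0.
  by apply: (@perm_inj _ cycle3); rewrite permKV permE; apply: ord_inj.
have c2 : cycle3^-1%g o2 = o1.
  by apply: (@perm_inj _ cycle3); rewrite permKV permE; apply: ord_inj.
have sE (v : 'I_3 -> V) :
    (j + op_act j cycle3 + op_act j (cycle3 ^+ 2)%g : end_space V 3) v =
    binop f (binop f (v ord0) (v o1)) (v o2)
    + binop f (binop f (v o2) (v ord0)) (v o1)
    + binop f (binop f (v o1) (v o2)) (v ord0).
  rewrite -jE; congr (_ + _ + _); rewrite /= [LHS]jE.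
    by rewrite c0 c1 c2.
  by rewrite expgS expg1 invMg !permM c0 c1 c2 c0 c1.
split=> [j0 x y z|f0]; last by apply: (@end_ext K V 3) => v; rewrite sE f0.
have := sE (fun i => if i == ord0 then x else if i == o1 then y else z).
by rewrite j0 /= => <-.
Qed.

End EndRelations.

(** * Lie brackets and morphisms out of [Lie] *)

Section LieOps.
Variable K : fieldType.

Lemma binop_linearl (V : lmodType K) (f : end_space V 2) y :
  linear (fun x => binop f x y).
Proof.
have /multilinearP/(_ ord0) fP := end_multilinear f.
by move=> a u v; apply: fP => // -[[|[|//]] lti].
Qed.

Lemma binop_linearr (V : lmodType K) (f : end_space V 2) x : linear (binop f x).
Proof.
have /multilinearP/(_ ord_max) fP := end_multilinear f.
by move=> a u v; apply: fP => // -[[|[|//]] lti].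
Qed.

(** Polarization: expand [br (x + y) (x + y) = 0]. *)
Lemma lie_bracketC (V : lmodType K) (br : V -> V -> V) :
  is_lie_bracket br -> forall x y, br x y = - br y x.
Proof.
move=> [brr brl brxx _] x y; apply/eqP; rewrite -addr_eq0; apply/eqP.
have brDr z u v : br z (u + v) = br z u + br z v.
  by have := brr z 1 u v; rewrite !scale1r.
have brDl z u v : br (u + v) z = br u z + br v z.
  by have := brl z 1 u v; rewrite !scale1r.
by have := brxx (x + y); rewrite brDr !brDl !brxx add0r addr0 addrC.
Qed.

Lemma lie_op_bracket (V : lmodType K) (charK : [pchar K] =i pred0)
    (Phi : operad_morph (Lie K) (end_operad V)) : is_lie_bracket (lie_op Phi).
Proof.
(* A relator lies in every ideal containing the relations, so its class in [Lie] is zero. *)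
have relP n (x : lie_free K n) : lie_rel x -> Phi n (quot_proj _ n x) = 0.
  move=> Rx; rewrite -(mor0 Phi); congr (Phi n _); rewrite -(mor0 (quot_proj _)).
  by apply/quot_piP; rewrite subr0; apply/asboolP => I; apply.
have /end_antisymP anti :
    Phi 2 (ell K) + op_act (Phi 2 (ell K)) (tperm ord0 ord_max) = 0.
  by have := relP _ _ (LieAntisym K); rewrite !(morD, mor_act).
have := relP _ _ (LieJacobi K); rewrite !(morD, mor_act) 2!mor_op_comp2 2!mor_one.
move=> /end_jacobiP jac.
have antiN x y : lie_op Phi x y = - lie_op Phi y x.
  by apply/eqP; rewrite -addr_eq0; apply/eqP/anti.
split=> [x|y|x|x y z]; [exact: binop_linearr|exact: binop_linearl| |].
  (* Antisymmetry only says that twice the bracket of [x] with itself vanishes; characteristic 0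
     makes 2 invertible. *)
  have /eqP := anti x x; rewrite -mulr2n -scaler_nat scaler_eq0.
  by have /pcharf0P-> := charK; move=> /eqP.
(* Antisymmetry turns the right-nested Jacobi sum into minus the left-nested one supplied by
   [jac]. *)
rewrite (antiN x (lie_op _ _ _)) (antiN y (lie_op _ _ _)).
rewrite (antiN z (lie_op _ _ _)) -!opprD addrAC.
by rewrite [X in - X](jac y z x) oppr0.
Qed.

Section OfLieAlgebra.
Variable g : lie_alg K.

Fact bracket_multilinear :
  @multilinear K 2 (fun=> g) g (fun v => bracket (v ord0) (v ord_max)).
Proof.
have [brr brl _ _] := bracketP g.
apply/multilinearP => -[[|[|//]] lti] a u v w; set i := Ordinal lti.
  have -> : i = ord0 by apply: ord_inj.
  by move=> -> /(_ ord_max isT)[<- <-]; apply: brl.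
have -> : i = ord_max by apply: ord_inj.
by move=> -> /(_ ord0 isT)[<- <-]; apply: brr.
Qed.

Definition bracket_end : end_space g 2 := end_of bracket_multilinear.

Definition gen_bracket n (p : lie_gen n) : end_operad g n :=
  match p with lie_bracket_gen => bracket_end end.

(** Built directly from [free_eval] rather than from the existence statement [free_operadP], so that
    [free_evalE] computes it on the generator. *)
Definition free_bracket : operad_morph (lie_free K) (end_operad g) :=
  @OperadMorph K (lie_free K) (end_operad g) (free_eval gen_bracket)
    (eval_linear gen_bracket) (@eval_act _ _ _ gen_bracket)
    (eval_one gen_bracket) (@eval_comp _ _ _ gen_bracket).

Lemma free_bracket_ell : free_bracket 2 (lie_free_ell K) = bracket_end.
Proof. exact: free_evalE. Qed.

Lemma free_bracket_rel n (x : lie_free K n) : lie_rel x -> free_bracket n x = 0.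
Proof.
have brC := lie_bracketC (bracketP g); have [_ _ _ brJ] := bracketP g.
case=> [|j]; rewrite !(morD, mor_act) ?mor_op_comp2 ?mor_one free_bracket_ell.
  by apply/end_antisymP => u v; rewrite /binop /= brC addNr.
apply/end_jacobiP => u v w; rewrite /binop /=.
(* Conversely, the left-nested sum becomes minus the right-nested one, which is [brJ]. *)
rewrite (brC (bracket u v)) (brC (bracket w u)) (brC (bracket v w)).
by rewrite -!opprD addrAC brJ oppr0.
Qed.

Definition Lie_bracket : operad_morph (Lie K) (end_operad g) :=
  lift_morph (ker_gen_ideal free_bracket_rel).

Lemma lie_op_Lie_bracket : lie_op Lie_bracket = @bracket K g.
Proof.
apply: funext => x; apply: funext => y.
rewrite /lie_op [X in binop X](_ : _ = bracket_end) //.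
by rewrite -free_bracket_ell; exact: (lift_fun_pi (ker_gen_ideal free_bracket_rel)).
Qed.

End OfLieAlgebra.

(** By [binop_eta] the binary operation determines the image of [ell], hence the whole morphism. *)
Lemma lie_op_inj (V : lmodType K) :
  injective (@lie_op K V).
Proof.
move=> f g fg; apply: Lie_morph_ext; apply: (@end_ext K V 2) => v.
by rewrite !binop_eta; exact: (congr1 (fun b => b _ _) fg).
Qed.

End LieOps.

Lemma lie_alg_ext (K : fieldType) (V : lmodType K) (br br' : V -> V -> V)
    (brP : is_lie_bracket br) (brP' : is_lie_bracket br') :
  br = br' -> LieAlgebra brP = LieAlgebra brP'.
Proof. by move=> E; subst br'; congr LieAlgebra; apply: Prop_irrelevance. Qed.

(** * The two functors, mutually inverse on objects *)

Section Functors.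
Variables (K : fieldType) (charK : [pchar K] =i pred0).

Definition lie_of_alg (A : Alg (Lie K)) : LieAlg K :=
  LieAlgebra (lie_op_bracket charK (alg_op A)).

Fact lie_of_alg_homP (A B : Alg (Lie K)) (f : alg_hom A B) (x y : A) :
  f (lie_op (alg_op A) x y) = lie_op (alg_op B) (f x) (f y).
Proof.
rewrite /lie_op /binop alg_homP; congr ((alg_op B 2 _ : end_space B 2) _).
by apply: funext => i; case: ifP.
Qed.

Definition lie_of_alg_hom (A B : Alg (Lie K)) (f : alg_hom A B) :
    lie_hom (lie_of_alg A) (lie_of_alg B) :=
  @LieHom K (lie_of_alg A) (lie_of_alg B) f (alg_hom_linear f)
    (lie_of_alg_homP f).

Fact lie_of_alg_id (X : Alg (Lie K)) : lie_of_alg_hom (idh X) = idh (lie_of_alg X).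
Proof. exact: lie_hom_ext. Qed.
Fact lie_of_alg_comp (X Y Z : Alg (Lie K)) (f : alg_hom Y Z) (f' : alg_hom X Y) :
  lie_of_alg_hom (alg_comp f f') = lie_comp (lie_of_alg_hom f) (lie_of_alg_hom f').
Proof. exact: lie_hom_ext. Qed.

Definition lie_of_alg_functor : functor (Alg (Lie K)) (LieAlg K) :=
  @Functor (Alg (Lie K)) (LieAlg K) lie_of_alg lie_of_alg_hom
    lie_of_alg_id lie_of_alg_comp.

Definition alg_of_lie (g : LieAlg K) : Alg (Lie K) := OpAlg (Lie_bracket g).

(** Induction on [x]: for [ell] this is [lie_homP], sums and scalings use linearity of [f], and the
    action and composition preserve compatibility with [f]. *)
Fact alg_of_lie_homP (g h : LieAlg K) (f : lie_hom g h) n (x : Lie K n)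
    (v : 'I_n -> g) :
  f ((Lie_bracket g n x : end_space g n) v) =
  (Lie_bracket h n x : end_space h n) (fun i => f (v i)).
Proof.
have fD : {morph f : y z / y + z}.
  by move=> y z; have := lie_hom_linear f 1 y z; rewrite !scale1r.
have f0 : f 0 = 0 by apply: (addrI (f 0)); rewrite -fD !addr0.
have fZ a : {morph f : y / a *: y}.
  by move=> y; have := lie_hom_linear f a y 0; rewrite f0 !addr0.
elim/Lie_ind: n / x v => [v|n v|n x y IHx IHy v|n a x IHx v|n x s IHx v|v
    |n k m e x y IHx IHy v].
- rewrite !binop_eta -/(lie_op _) -/(lie_op (Lie_bracket h)).
  by rewrite !lie_op_Lie_bracket lie_homP.
- by rewrite !mor0.
- by rewrite !morD [LHS]fD IHx IHy.
- by rewrite !morZ [LHS]fZ IHx.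
- by rewrite !mor_act [LHS]IHx.
- by rewrite !mor_one.
- rewrite !mor_comp [LHS]IHx; congr ((Lie_bracket h n x : end_space h n) _).
  by apply: funext => i; rewrite IHy.
Qed.

Definition alg_of_lie_hom (g h : LieAlg K) (f : lie_hom g h) :
    alg_hom (alg_of_lie g) (alg_of_lie h) :=
  @AlgHom K (Lie K) (alg_of_lie g) (alg_of_lie h) f (lie_hom_linear f)
    (alg_of_lie_homP f).

Fact alg_of_lie_id (X : LieAlg K) : alg_of_lie_hom (idh X) = idh (alg_of_lie X).
Proof. exact: alg_hom_ext. Qed.
Fact alg_of_lie_comp (X Y Z : LieAlg K) (f : lie_hom Y Z) (f' : lie_hom X Y) :
  alg_of_lie_hom (lie_comp f f') = alg_comp (alg_of_lie_hom f) (alg_of_lie_hom f').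
Proof. exact: alg_hom_ext. Qed.

Definition alg_of_lie_functor : functor (LieAlg K) (Alg (Lie K)) :=
  @Functor (LieAlg K) (Alg (Lie K)) alg_of_lie alg_of_lie_hom
    alg_of_lie_id alg_of_lie_comp.

(** The carrier is kept definitionally, so only the operad morphisms are compared, and their
    brackets determine them. *)
Lemma lie_of_algK : cancel lie_of_alg alg_of_lie.
Proof.
case=> V Phi; congr OpAlg; apply: lie_op_inj; exact: lie_op_Lie_bracket.
Qed.

Lemma alg_of_lieK : cancel alg_of_lie lie_of_alg.
Proof. by case=> V br brP; apply: lie_alg_ext; apply: lie_op_Lie_bracket. Qed.

End Functors.

(** * Equality of functors *)

(* [existT_inj2] through [{classic T}] would make the universes inconsistent for
   [T] a type of objects. *)
Lemma existT_inj (T : Type) (P : T -> Type) (x : T) : injective (existT P x).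
Proof.
(* [Q] records a path between first components, so [ab] can be rewritten inside it; proof
   irrelevance then trivializes the path. *)
pose Q a (s : {y & P y}) := exists e : x = tag s, ecast y (P y) e a = tagged s.
move=> a b ab; have [/= e <-] : Q a (existT P x b) by rewrite -ab; exists erefl.
by rewrite (Prop_irrelevance e erefl).
Qed.

(* Morphisms are compared together with their source and target, so that no
   transport along the equalities between objects is needed. *)
Definition hom_pack (C : category) (X Y : C) (f : Defs.hom X Y) :
    {p : C * C & Defs.hom p.1 p.2} :=
  existT (fun p : C * C => Defs.hom p.1 p.2) (X, Y) f.

Lemma functor_ext (C D : category) (F G : functor C D) :
  (forall X Y (f : Defs.hom X Y), hom_pack (fmap F f) = hom_pack (fmap G f)) -> F = G.
Proof.
case: F G => [F Ff Fi Fc] [G Gf Gi Gc] /= FG.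
(* The object maps are recovered from the packed images of identities. *)
have E : F = G.
  by apply: funext => X; have := congr1 (fun s => (projT1 s).1) (FG X X (idh X)).
subst G; have E : Ff = Gf.
  apply: functional_extensionality_dep => X; apply: functional_extensionality_dep => Y.
  apply: funext => f; exact: existT_inj (FG X Y f).
by subst Gf; congr Functor; apply: Prop_irrelevance.
Qed.

(** Once sources and targets are identified, a morphism is its underlying map; propositional
    equality of the objects suffices. *)
Lemma alg_hom_pack (K : fieldType) (P : operad K) (A B A' B' : Alg P)
    (f : alg_hom A B) (f' : alg_hom A' B') :
  A' = A -> B' = B -> map_of f' = map_of f ->
  @hom_pack (Alg P) A' B' f' = @hom_pack (Alg P) A B f.
Proof.
move=> eA eB; subst A' B' => ff'; congr hom_pack; apply: alg_hom_ext => x.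
by rewrite (existT_inj ff').
Qed.

Lemma lie_hom_pack (K : fieldType) (g h g' h' : LieAlg K)
    (f : lie_hom g h) (f' : lie_hom g' h') :
  g' = g -> h' = h -> map_of f' = map_of f ->
  @hom_pack (LieAlg K) g' h' f' = @hom_pack (LieAlg K) g h f.
Proof.
move=> eg eh; subst g' h' => ff'; congr hom_pack; apply: lie_hom_ext => x.
by rewrite (existT_inj ff').
Qed.

Theorem theorem5p33 (K : fieldType) (charK : [pchar K] =i pred0) :
  exists (F : functor (Alg (Lie K)) (LieAlg K))
         (G : functor (LieAlg K) (Alg (Lie K))),
    [/\ (* F(V, Phi) = (V, Phi_2(ell)) and F(f) = f *)
        forall (V : lmodType K) (Phi : operad_morph (Lie K) (end_operad V)),
          exists br : is_lie_bracket (lie_op Phi),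
            F (OpAlg Phi) = LieAlgebra br,
        forall (A B : Alg (Lie K)) (f : alg_hom A B),
          map_of (fmap F f : lie_hom (F A) (F B)) = map_of f,
        (* G(g, [-,-]) = (g, Phi), Phi the unique operad morphism with
           Phi_2(ell) = [-,-], and G(f) = f *)
        forall g : LieAlg K,
          exists Phi : operad_morph (Lie K) (end_operad (lie_sort g)),
            unique (fun Phi' => lie_op Phi' = @bracket K g) Phi
            /\ G g = OpAlg Phi,
        forall (g h : LieAlg K) (f : lie_hom g h),
          map_of (fmap G f : alg_hom (G g) (G h)) = map_of f
      & inverse_functors F G].
Proof.
exists (lie_of_alg_functor charK), (alg_of_lie_functor K); split=> [V Phi|//|g|//|].
- by exists (lie_op_bracket charK Phi).
- exists (Lie_bracket g); split=> //; split=> [|Phi brPhi].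
    exact: lie_op_Lie_bracket.
  by apply: lie_op_inj; rewrite brPhi lie_op_Lie_bracket.
(* Both composites leave underlying maps unchanged, so only the cancellations on objects remain. *)
- split; apply: functor_ext => X Y f.
    by apply: alg_hom_pack => //; apply: lie_of_algK.
  by apply: lie_hom_pack => //; apply: alg_of_lieK.
Qed.
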